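(* Let $M$ be the simple digraph with six-element vertex set $\{a,b,a_0,b_0,a_1,b_1\}$ and arrow relation $$E=\{\langle a,a\rangle,\langle a,b\rangle,\langle b,a\rangle,\langle b,b\rangle,\langle a_0,b_0\rangle,\langle b_0,a_1\rangle,\langle a_1,b_1\rangle,\langle b_1,a_0\rangle,\langle a,a_0\rangle,\langle a,a_1\rangle,\langle b,b_0\rangle,\langle b,b_1\rangle\}.$$ Then $M$ is homogeneous but not uniformly homogeneous.
   Context: A simple digraph is a structure $\langle X,E\rangle$ where $E$ is a binary relation on $X$ (loops are allowed). Substructures are subsets with the induced relation; isomorphisms are bijections preserving the relation in both directions. A structure $M$ is homogeneous if every isomorphism between finitely generated substructures of $M$ extends to an automorphism of $M$. A structure $M$ is uniformly homogeneous if there is a functor $K$ from the category of all isomorphisms between finitely generated substructures of $M$ into the group $\operatorname{Aut}(M)$ (viewed as a category with a single object) such that $K(f)$ is an extension of $f$ for each $f$. Equivalently, $K$ assigns to each isomorphism $f$ between finitely generated substructures of $M$ a map $K(f)$ so that: (1) $K(\mathrm{id}_A)=\mathrm{id}_M$; (2) $K(f)\in\operatorname{Aut}(M)$ and $K(f)$ extends $f$; (3) $K(f\circ g)=K(f)\circ K(g)$, for all isomorphisms $f\colon A\to B$, $g\colon C\to A$ with $A,B,C$ finitely generated substructures of $M$. *)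

(* Defs.v *)
From HB Require Import structures.
From mathcomp Require Import all_boot finmap.

Set Implicit Arguments.
Unset Strict Implicit.
Unset Printing Implicit Defensive.

Local Open Scope fset_scope.

(* A simple digraph is a type T with an arbitrary relation E, loops allowed.
   The language is relational, so the finitely generated substructures are
   exactly the finite subsets of T with the induced relation. *)
Section Homogeneity.

Variables (T : choiceType) (E : rel T).

(* Finite functions make pointwise equal isomorphisms Leibniz-equal. *)
Definition is_iso (A B : {fset T}) (f : {ffun A -> B}) : Prop :=
  bijective f /\ forall x y : A, E (val (f x)) (val (f y)) = E (val x) (val y).

Definition is_aut (g : T -> T) : Prop :=
  bijective g /\ forall x y : T, E (g x) (g y) = E x y.

Definition extends (A B : {fset T}) (g : T -> T) (f : {ffun A -> B}) : Prop :=
  forall x : A, g (val x) = val (f x).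

Definition homogeneous : Prop :=
  forall (A B : {fset T}) (f : {ffun A -> B}),
    is_iso f -> exists g : T -> T, is_aut g /\ extends g f.

(* K is total on finite functions; only its values at isomorphisms matter. *)
Definition uniformly_homogeneous : Prop :=
  exists K : forall A B : {fset T}, {ffun A -> B} -> T -> T,
    [/\ forall A : {fset T}, K A A [ffun x => x] =1 id,
        forall (A B : {fset T}) (f : {ffun A -> B}),
          is_iso f -> is_aut (K A B f) /\ extends (K A B f) f
      & forall (A B C : {fset T}) (f : {ffun A -> B}) (g : {ffun C -> A}),
          is_iso f -> is_iso g ->
          K C B [ffun x => f (g x)] =1 K A B f \o K C A g].

End Homogeneity.

Inductive vertex : Type := va | vb | va0 | vb0 | va1 | vb1.

Definition vertex_code (v : vertex) : 'I_6 :=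
  match v with
  | va => @Ordinal 6 0 isT
  | vb => @Ordinal 6 1 isT
  | va0 => @Ordinal 6 2 isT
  | vb0 => @Ordinal 6 3 isT
  | va1 => @Ordinal 6 4 isT
  | vb1 => @Ordinal 6 5 isT
  end.

Definition vertex_decode (i : 'I_6) : vertex :=
  nth va [:: va; vb; va0; vb0; va1; vb1] i.

Lemma vertex_codeK : cancel vertex_code vertex_decode.
Proof. by case. Qed.

HB.instance Definition _ := Finite.copy vertex (can_type vertex_codeK).

Definition arrow : rel vertex := fun x y =>
  (x, y) \in [:: (va, va); (va, vb); (vb, va); (vb, vb);
                 (va0, vb0); (vb0, va1); (va1, vb1); (vb1, va0);
                 (va, va0); (va, va1); (vb, vb0); (vb, vb1)].

(* Main.v *)
(* Rotating the 4-cycle a0 -> b0 -> a1 -> b1 while exchanging a and b generates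
   a group of automorphisms that is transitive on looped and on unlooped
   vertices.  An isomorphism f between induced subgraphs agrees with such a
   rotation at one vertex z of its domain, taken outside {a, b} if possible;
   since loops and adjacency to z tell the vertices of the domain apart, f agrees
   with the rotation everywhere.  On the other hand, exchanging a and b is an involution
   of {a, b}, but an automorphism exchanging a and b rotates the 4-cycle by an
   odd number of steps, so it has order 4. *)
From mathcomp Require Import all_boot finmap.
Require Import Defs.

Local Open Scope fset_scope.

Definition rot (v : vertex) : vertex :=
  match v with
  | va => vb | vb => va
  | va0 => vb0 | vb0 => va1 | va1 => vb1 | vb1 => va0
  end.

Lemma is_aut_comp (T : choiceType) (E : rel T) (g h : T -> T) :
  is_aut E g -> is_aut E h -> is_aut E (g \o h).
Proof.
move=> [bij_g Eg] [bij_h Eh]; split; first exact: bij_comp.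
by move=> x y; rewrite /= Eg Eh.
Qed.

Lemma is_aut_id (T : choiceType) (E : rel T) : is_aut E id.
Proof. by split=> //; exists id. Qed.

Lemma is_aut_rot : is_aut arrow rot.
Proof. by split; [exists (iter 3 rot); case | do 2 case]. Qed.

Lemma is_aut_iter_rot k : is_aut arrow (iter k rot).
Proof.
elim: k => [|k IHk]; first exact: is_aut_id.
exact: is_aut_comp is_aut_rot IHk.
Qed.

Lemma rot_transitive x y :
  arrow x x = arrow y y -> exists k, iter k rot x = y.
Proof.
by case: x; case: y => // _;
  first [by exists 0 | by exists 1 | by exists 2 | by exists 3].
Qed.

(** The first hypothesis is there because a looped [z] cannot tell apart its two unlooped
    out-neighbours, such as [va0] and [va1] for [va]. *)
Lemma arrow_separates z y y' :
    (arrow z z -> arrow y y) -> arrow y' y' = arrow y y ->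
    arrow z y' = arrow z y -> arrow y' z = arrow y z ->
    (y' == z) = (y == z) ->
  y' = y.
Proof. by case: z; case: y => //; case: y' => // /(_ isT). Qed.

Lemma arrow_homogeneous : homogeneous arrow.
Proof.
move=> A B f [/bij_inj inj_f Ef].
have extends_from (z : A) :
    (arrow (val z) (val z) -> forall y : A, arrow (val y) (val y)) ->
  exists g, is_aut arrow g /\ extends g f.
  move=> z_loop; have [k gz] := rot_transitive _ _ (esym (Ef z z)).
  have [bij_g Eg] := is_aut_iter_rot k.
  exists (iter k rot); split=> // y; apply: (arrow_separates (val (f z))).
  - by rewrite !Ef => /z_loop.
  - by rewrite Eg Ef.
  - by rewrite -[in LHS]gz Eg Ef.
  - by rewrite -[in LHS]gz Eg Ef.
  - by rewrite -[in LHS]gz (bij_eq bij_g) !val_eqE (inj_eq inj_f).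
have [z z_loopless|all_loops] := pickP (fun z : A => ~~ arrow (val z) (val z)).
  by apply: (extends_from z) => z_loop; rewrite z_loop in z_loopless.
have loop (y : A) : arrow (val y) (val y) by apply/negPn; rewrite all_loops.
have [z _|A_empty] := pickP (@predT A); first by apply: (extends_from z).
exists id; split; first exact: is_aut_id.
by move=> x; have := A_empty x.
Qed.

(** Such a [g] sends [va0] to [vb0] or [vb1]; swapping the two would reverse the arrow between
    them. *)
Lemma no_involutive_exchange g :
  is_aut arrow g -> g va = vb -> ~ involutive g.
Proof.
move=> [_ Eg] ga gK; move: (Eg va va0) (Eg va0 va0); rewrite ga.
case g_a0: (g va0) => // _ _.
- by move: (Eg va0 vb0); rewrite -g_a0 gK g_a0.
- by move: (Eg vb1 va0); rewrite -g_a0 gK g_a0.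
Qed.

Lemma arrow_not_uniformly_homogeneous : ~ uniformly_homogeneous arrow.
Proof.
move=> [K [K_id K_ext K_comp]].
pose A : {fset vertex} := [fset va; vb].
have rotA (x : A) : rot (val x) \in A.
  by case: x => x /=; rewrite !inE => /orP[] /eqP->.
pose f : {ffun A -> A} := [ffun x => [` rotA x]].
have fE x : val (f x) = rot (val x) by rewrite ffunE.
have fK : involutive f.
  move=> x; apply: val_inj; rewrite !fE.
  by case: x => x /=; rewrite !inE => /orP[] /eqP->.
have iso_f : is_iso arrow f.
  by split=> [|x y]; [exists f | rewrite !fE is_aut_rot.2].
have [aut_g g_ext] := K_ext _ _ _ iso_f.
have aA : va \in A by rewrite !inE.
apply: (no_involutive_exchange _ aut_g).
  by rewrite (g_ext [` aA]) fE.
(* Functoriality makes [K A A f] an involution, since [f] is one. *)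
move=> x; rewrite -[LHS](K_comp _ _ _ _ _ iso_f iso_f) -[RHS](K_id A).
by congr (K A A _ x); apply/ffunP => y; rewrite [LHS]ffunE [RHS]ffunE fK.
Qed.

Theorem theorem2p1 : homogeneous arrow /\ ~ uniformly_homogeneous arrow.
Proof.
split; [exact: arrow_homogeneous | exact: arrow_not_uniformly_homogeneous].
Qed.
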